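(* Let $\mathcal{R}:\mathbb{X}\to\mathbb{Y}$ be a local randomizer and let $x_1^0,x_1^1\in\mathbb{X}$. Define $$S_{r_0,r_1}=\Big\{y\ \Big|\ \frac{\mathcal{R}(x_1^0)(y)}{\inf_{x}\mathcal{R}(x)(y)}=r_0,\ \frac{\mathcal{R}(x_1^1)(y)}{\inf_{x}\mathcal{R}(x)(y)}=r_1\Big\}.$$ Then the following decomposition under the general clone paradigm is equivalent to the privacy blanket framework: $$\mathcal{R}(x_1^0)=\sum_{r_0,r_1}a_{r_0,r_1}Q_{r_0,r_1},\qquad \mathcal{R}(x_1^1)=\sum_{r_0,r_1}b_{r_0,r_1}Q_{r_0,r_1},$$ $$\forall i\in\{2,\dots,n\}:\quad \mathcal{R}(x_i)=\sum_{r_0,r_1}c_{r_0,r_1}Q_{r_0,r_1}+\beta Q_i,$$ where the sums range over the values taken by the pair of ratios $(r_0,r_1)$, $$a_{r_0,r_1}=\sum_{y\in S_{r_0,r_1}}\mathcal{R}(x_1^0)(y),\qquad b_{r_0,r_1}=\sum_{y\in S_{r_0,r_1}}\mathcal{R}(x_1^1)(y),$$ $$c_{r_0,r_1}=\sum_{y\in S_{r_0,r_1}}\inf_{x}\mathcal{R}(x)(y)=\sum_{y\in S_{r_0,r_1}}\gamma\,\omega(y),$$ the distribution $Q_{r_0,r_1}$ is defined by $$Q_{r_0,r_1}(y)=\begin{cases}\dfrac{\mathcal{R}(x_1^0)(y)}{a_{r_0,r_1}},& y\in S_{r_0,r_1},\\[1ex] 0,& y\notin S_{r_0,r_1},\end{cases}$$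 $\beta=1-\sum_{r_0,r_1}c_{r_0,r_1}$, and $Q_i$ is the resulting left-over distribution of $x_i$.
   Context: A local randomizer $\mathcal{R}:\mathbb{X}\to\mathbb{Y}$ is a randomized map; $\mathcal{R}(x)$ denotes its output distribution on input $x$ and $\mathcal{R}(x)(y)$ the probability (density) of $\mathcal{R}(x)$ at $y$. Infima $\inf_x$ are over $x\in\mathbb{X}$. $n\ge 1$ is the number of users; $x_1^0,x_1^1$ are the two possible inputs of the first user and $x_2,\dots,x_n\in\mathbb{X}$ are the inputs of the other users. General clone decomposition of $\mathcal{R}$ with respect to $(x_1^0,x_1^1)$: probability distributions $Q_1^j$ on $\mathbb{Y}$ (the components, indexed by $j$; in the claim the index is the pair $(r_0,r_1)$), non-negative coefficients $a_j,b_j,c_j,\beta$ with $\sum_j a_j=1$, $\sum_j b_j=1$, $\beta+\sum_j c_j=1$, and for each $i\in\{2,\dots,n\}$ a probability distribution $Q_i$ on $\mathbb{Y}$ depending only on $x_i$, such that $\mathcal{R}(x_1^0)=\sum_j a_jQ_1^j$, $\mathcal{R}(x_1^1)=\sum_j b_jQ_1^j$, and $\mathcal{R}(x_i)=\sum_j c_jQ_1^j+\beta Q_i$ for all $i\in\{2,\dots,n\}$. Here $Q_i=\frac1\beta\big(\mathcal{R}(x_i)-\sum_j c_jQ_1^j\big)$ is called the left-over distribution of $x_i$ (arbitrary if $\beta=0$). Its reduction pair $(P_0^{\mathsf{GC}},P_1^{\mathsf{GC}})$: let $A_0,A_1,A_2$ be random variables on the index set of the components together with one extra index $\bot$, with $\Pr[A_0=j]=a_j$,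 $\Pr[A_1=j]=b_j$, $\Pr[A_2=j]=c_j$ for each component index $j$, and $\Pr[A_0=\bot]=\Pr[A_1=\bot]=0$, $\Pr[A_2=\bot]=\beta$. For $a\in\{0,1\}$, $P_a^{\mathsf{GC}}$ is the distribution of the histogram (counts of each index) of $n$ independent samples, one from $A_a$ and $n-1$ from $A_2$. Privacy blanket framework: $\gamma=\int\inf_{x}\mathcal{R}(x)(y)\,\mathrm{d}y$ (a sum over $y$ when $\mathbb{Y}$ is discrete) and $\omega(y)=\inf_{x}\mathcal{R}(x)(y)/\gamma$. Its reduction pair $(P_0^{\mathsf{B}},P_1^{\mathsf{B}})$: for $a\in\{0,1\}$, $P_a^{\mathsf{B}}$ is the distribution of $(|\boldsymbol b|,Y^a_{|\boldsymbol b|})$, where $|\boldsymbol b|\sim\mathrm{Bin}(n-1,\gamma)$ and, given $|\boldsymbol b|=m$, $Y^a_m$ is the multiset consisting of one sample from $\mathcal{R}(x_1^a)$ and $m$ independent samples from $\omega$. A general clone decomposition is equivalent to the privacy blanket framework if, for every $n\ge1$, there are (possibly randomized) post-processing functions $f,g$ with $f(P_a^{\mathsf{B}})=P_a^{\mathsf{GC}}$ and $g(P_a^{\mathsf{GC}})=P_a^{\mathsf{B}}$ in distribution for both $a=0,1$ (the same $f$ and the same $g$ for $a=0$ and $a=1$).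
   Formalization: The formal theorem assumes that inf_x R(x)(y) > 0 at every y where R(x_1^0)(y) > 0 or R(x_1^1)(y) > 0; without this the ratios are undefined at such y, and the stated decomposition can fail. *)

(* Defs.v *)
From HB Require Import structures.
From mathcomp Require Export all_boot all_order all_algebra.
From mathcomp Require Export finmap multiset.
From mathcomp Require Export all_classical all_reals all_analysis.

Set Implicit Arguments.
Unset Strict Implicit.
Unset Printing Implicit Defensive.

Import Order.TTheory GRing.Theory Num.Theory.
Local Open Scope classical_set_scope.
Local Open Scope ring_scope.

(* Only meaningful for [f] nonnegative on [A] with finite sum: [\esum] is a
   supremum of finite partial sums, and [fine] sends +oo to 0. *)
Definition rsum (R : realType) (T : choiceType) (A : set T) (f : T -> R) : R :=
  fine (\esum_(t in A) (f t)%:E).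

(* Distributions are discrete and given by their mass function; the support
   is necessarily countable, whatever the carrier. *)
Definition is_pmf (R : realType) (T : choiceType) (p : T -> R) : Prop :=
  (forall t, 0 <= p t) /\ \esum_(t in [set: T]) (p t)%:E = 1%E.

Definition is_markov (R : realType) (T : Type) (U : choiceType)
    (f : T -> U -> R) : Prop :=
  forall t, is_pmf (f t).

(* [f(p) = q] in distribution, for a randomized function [f]. *)
Definition postprocesses (R : realType) (T U : choiceType)
    (f : T -> U -> R) (p : T -> R) (q : U -> R) : Prop :=
  forall u, \esum_(t in [set: T]) (p t * f t u)%:E = (q u)%:E.

(* Law of the multiset formed by one sample from [p] and [m] samples from [q],
   all independent. A multiset is a finitely supported function to [nat], so
   this is also the law of the histogram of these samples. *)
Definition multiset_law (R : realType) (T : choiceType) (p q : T -> R)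
    (m : nat) (h : {mset T}%mset) : R :=
  rsum [set t : T * m.-tuple T | seq_mset (t.1 :: t.2) = h]
       (fun t => p t.1 * \prod_(i < m) q (tnth t.2 i)).

Section Blanket.
Context (R : realType) (X : Type) (Y : choiceType) (Rnd : X -> Y -> R).

Definition inf_mass (y : Y) : R := inf [set Rnd x y | x in [set: X]].

Definition blanket_gamma : R := rsum [set: Y] inf_mass.

Definition blanket_omega (y : Y) : R := inf_mass y / blanket_gamma.

Definition blanket_law (n : nat) (x : X) (z : nat * {mset Y}%mset) : R :=
  binomial_pmf n.-1 blanket_gamma z.1
  * multiset_law (Rnd x) blanket_omega z.1 z.2.

End Blanket.

Record clone_data (R : realType) (Y : choiceType) := CloneData {
  clone_idx : choiceType;
  clone_Q : clone_idx -> Y -> R;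
  clone_a : clone_idx -> R;
  clone_b : clone_idx -> R;
  clone_c : clone_idx -> R;
  clone_beta : R
}.

Section Clone.
Context (R : realType) (X : Type) (Y : choiceType) (Rnd : X -> Y -> R).
Context (x10 x11 : X) (D : clone_data R Y).
Let J := clone_idx D.

Definition is_leftover (x : X) (L : Y -> R) : Prop :=
  (clone_beta D != 0 ->
     forall y, L y = (clone_beta D)^-1
       * (Rnd x y - rsum [set: J] (fun j => clone_c j * clone_Q j y)))
  /\ (clone_beta D = 0 -> is_pmf L).

(* [xs] lists the inputs of the users 2, ..., n; [L x] plays the role of Q_i
   when x_i = x. *)
Definition is_clone_decomposition (n : nat) (xs : 'I_n.-1 -> X)
    (L : X -> Y -> R) : Prop :=
  (forall j : J, is_pmf (clone_Q j))
  /\ is_pmf (@clone_a _ _ D)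
  /\ is_pmf (@clone_b _ _ D)
  /\ (forall j : J, 0 <= clone_c j)
  /\ 0 <= clone_beta D
  /\ ((clone_beta D)%:E + \esum_(j in [set: J]) (clone_c j)%:E = 1)%E
  /\ (forall i, is_pmf (L (xs i)))
  /\ (forall y, (Rnd x10 y)%:E
        = \esum_(j in [set: J]) (clone_a j * clone_Q j y)%:E)
  /\ (forall y, (Rnd x11 y)%:E
        = \esum_(j in [set: J]) (clone_b j * clone_Q j y)%:E)
  /\ (forall i y, (Rnd (xs i) y)%:E
        = (\esum_(j in [set: J]) (clone_c j * clone_Q j y)%:E
           + (clone_beta D * L (xs i) y)%:E)%E).

(* [None] is the extra index \bot, with mass [bot]. *)
Definition with_bot (w : J -> R) (bot : R) (o : option J) : R :=
  if o is Some j then w j else bot.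

(* Reduction pair: [w] is [clone_a D] for P_0 and [clone_b D] for P_1. *)
Definition clone_law (n : nat) (w : J -> R) : {mset (option J)}%mset -> R :=
  multiset_law (with_bot w 0)
               (with_bot (@clone_c _ _ D) (clone_beta D)) n.-1.

Definition equivalent_to_blanket : Prop :=
  forall n : nat, (0 < n)%N ->
    (exists f : nat * {mset Y}%mset -> {mset (option J)}%mset -> R,
       is_markov f
       /\ postprocesses f (blanket_law Rnd n x10)
                          (clone_law n (@clone_a _ _ D))
       /\ postprocesses f (blanket_law Rnd n x11)
                          (clone_law n (@clone_b _ _ D)))
    /\ (exists g : {mset (option J)}%mset -> nat * {mset Y}%mset -> R,
       is_markov g
       /\ postprocesses g (clone_law n (@clone_a _ _ D))
                          (blanket_law Rnd n x10)
       /\ postprocesses g (clone_law n (@clone_b _ _ D))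
                          (blanket_law Rnd n x11)).

End Clone.

Section RatioClone.
Context (R : realType) (X : Type) (Y : choiceType) (Rnd : X -> Y -> R).
Context (x10 x11 : X).

(* Points with zero infimum have no ratios and lie in no class; without the
   first conjunct the convention z / 0 = 0 would put them in the class of
   (0, 0). *)
Definition ratio_class (r : R * R) : set Y :=
  [set y | [/\ 0 < inf_mass Rnd y,
               Rnd x10 y / inf_mass Rnd y = r.1
             & Rnd x11 y / inf_mass Rnd y = r.2]].

Definition ratio_values : set (R * R) := [set r | ratio_class r !=set0].

Definition ratio_a (r : R * R) : R := rsum (ratio_class r) (Rnd x10).
Definition ratio_b (r : R * R) : R := rsum (ratio_class r) (Rnd x11).
Definition ratio_c (r : R * R) : R := rsum (ratio_class r) (inf_mass Rnd).

Definition ratio_Q (r : R * R) (y : Y) : R :=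
  if `[< ratio_class r y >] then Rnd x10 y / ratio_a r else 0.

Definition ratio_clone : clone_data R Y :=
  {| clone_idx := set_type ratio_values;
     clone_Q := fun r => ratio_Q (val r);
     clone_a := fun r => ratio_a (val r);
     clone_b := fun r => ratio_b (val r);
     clone_c := fun r => ratio_c (val r);
     clone_beta := 1 - rsum [set: set_type ratio_values]
                            (fun r => ratio_c (val r)) |}.

End RatioClone.

(* Main.v *)
(* Let cl(y) be the pair of ratios of y. On a class S_r the laws R(x_1^0),
   R(x_1^1) and omega are all proportional to the infimum, hence share the same
   conditional law Q_r given the class. So mapping each sample y of the blanket
   output to cl(y), and padding with \bot up to n entries, gives the clone
   histogram: n - 1 samples from the mixture of omega (weight gamma) and \bot
   contain a binomial number of samples from omega. Conversely, drawing afresh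
   from Q_r for each occurrence of r in the histogram restores the blanket
   output, since the class of y followed by a draw from Q_cl(y) has the law of y
   for each of the three laws. *)
Require Import Defs.
Import Order.TTheory GRing.Theory Num.Theory.
Local Open Scope classical_set_scope.
Local Open Scope ring_scope.

Set Implicit Arguments.
Unset Strict Implicit.
Unset Printing Implicit Defensive.

(** * Sums of nonnegative extended reals over arbitrary sets *)

Section Esum.
Context (R : realType).

(** Only one inequality needs the supremum; for positive [c] the reverse one is the same inequality
    applied to [c^-1] and the scaled family. *)
Lemma esumZl (T : choiceType) (A : set T) (c : R) (f : T -> \bar R) : 0 <= c ->
  (forall t, 0 <= f t)%E ->
  (\esum_(t in A) (c%:E * f t) = c%:E * \esum_(t in A) f t)%E.
Proof.
move=> c0 f0; have le_scale d (g : T -> \bar R) : 0 <= d -> (forall t, 0 <= g t)%E ->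
    (\esum_(t in A) (d%:E * g t) <= d%:E * \esum_(t in A) g t)%E.
  move=> d0 g0; apply: ge_ereal_sup => _ [F AF <-].
  rewrite -ge0_mule_fsumr//.
  by rewrite lee_wpmul2l ?lee_fin//; apply: ereal_sup_ubound; exists F.
apply/eqP; rewrite eq_le le_scale//=.
have [->|cN0] := eqVneq c 0.
  by rewrite mul0e esum_ge0// => t _; rewrite mul0e.
have {cN0}c0 : 0 < c by rewrite lt_def cN0.
rewrite -[leRHS]mul1e -[1%E]/(1%:E) -(divff (lt0r_neq0 c0)) EFinM -muleA.
rewrite lee_wpmul2l ?lee_fin ?(ltW c0)//.
rewrite [leLHS](_ : _ = \esum_(t in A) ((c^-1)%:E * (c%:E * f t)))%E.
  by rewrite le_scale ?invr_ge0 ?(ltW c0)// => t; rewrite mule_ge0// lee_fin ltW.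
by apply: eq_esum => t _; rewrite muleA -EFinM mulVf ?gt_eqF// mul1e.
Qed.

Lemma esum_exchange (T U : choiceType) (f : T -> U -> \bar R) :
  (forall t u, 0 <= f t u)%E ->
  \esum_(t in [set: T]) \esum_(u in [set: U]) f t u
  = \esum_(u in [set: U]) \esum_(t in [set: T]) f t u.
Proof.
move=> f0; rewrite !esum_esum//.
apply: (@reindex_esum _ _ _ _ _ (fun k => (k.2, k.1)) (fun k => f k.1 k.2)).
by split => // [[a b] [c d] _ _ [-> ->]//|[a b] _]; exists (b, a).
Qed.

Lemma esum_supp1 (T : choiceType) (x : T) (f : T -> \bar R) : (0 <= f x)%E ->
  (forall t, t != x -> f t = 0%E) -> \esum_(t in [set: T]) f t = f x.
Proof.
move=> fx0 f0; rewrite -(@esum_set1 _ _ x f)// [RHS]esum_mkcond.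
apply: eq_esum => t _; case: ifPn => // /negP; rewrite inE /= => /eqP.
exact: f0.
Qed.

Lemma esum_bool (f : bool -> \bar R) : (forall b, 0 <= f b)%E ->
  \esum_(b in [set: bool]) f b = (f true + f false)%E.
Proof.
move=> f0; rewrite (esumID [set true])// !setTI esum_set1//.
rewrite [X in esum X](_ : _ = [set false]) ?esum_set1//.
by apply/seteqP; split => -[] //= [].
Qed.

Lemma le_esum1 (T : choiceType) (A : set T) (f : T -> \bar R) t :
  (forall t, 0 <= f t)%E -> A t ->
  (f t <= \esum_(s in A) f s)%E.
Proof.
move=> f0 At; rewrite -[leLHS](@esum_set1 _ _ t f)// esum_mkcond.
rewrite [leRHS]esum_mkcond; apply: le_esum => s _.
case: ifPn; first by rewrite inE /= => ->; rewrite mem_set.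
by case: ifP.
Qed.

End Esum.

(** * Discrete distributions as a monad *)

Record dist (R : realType) (T : choiceType) :=
  Dist { mass :> T -> R; mass_pmf : is_pmf mass }.

Section Dist.
Context (R : realType).
Implicit Types T U V : choiceType.

Lemma mass_ge0 T (p : dist R T) t : 0 <= p t.
Proof. by case: p => p []. Qed.
Hint Resolve mass_ge0 : core.

Lemma mass_sum1 T (p : dist R T) : \esum_(t in [set: T]) (p t)%:E = 1%E.
Proof. by case: p => p []. Qed.

Lemma mass_le1 T (p : dist R T) t : p t <= 1.
Proof.
rewrite -lee_fin -(mass_sum1 p) -(@esum_set1 _ _ t (fun t => (p t)%:E)) ?lee_fin//.
rewrite esum_mkcond; apply: le_esum => i _.
by case: ifP; rewrite lee_fin.
Qed.

(** Proof irrelevance identifies the [is_pmf] certificates, so laws can be compared by rewriting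
    them as terms. *)
Lemma dist_ext T (p q : dist R T) : p =1 q -> p = q.
Proof.
case: p q => [p hp] [q hq] /= /funext eq_pq.
by move: hq; rewrite -eq_pq => hq; congr Dist; exact: Prop_irrelevance.
Qed.

Definition dbind_mass T U (p : dist R T) (k : T -> dist R U) u : R :=
  fine (\esum_(t in [set: T]) (p t * k t u)%:E).

(** Since [k t u] is at most 1, the sum is dominated by the total mass of [p]; it is finite and
    [fine] loses nothing. *)
Lemma dbind_massE T U (p : dist R T) (k : T -> dist R U) u :
  (dbind_mass p k u)%:E = \esum_(t in [set: T]) (p t * k t u)%:E.
Proof.
rewrite fineK// ge0_fin_numE; last by apply: esum_ge0 => *; rewrite lee_fin mulr_ge0.
apply: le_lt_trans (ltry 1); rewrite -[leRHS](mass_sum1 p); apply: le_esum => t _.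
by rewrite lee_fin ler_piMr// mass_le1.
Qed.

Lemma dbind_pmf T U (p : dist R T) (k : T -> dist R U) : is_pmf (dbind_mass p k).
Proof.
split => [u|]; first by apply/fine_ge0/esum_ge0 => *; rewrite lee_fin mulr_ge0.
under eq_esum do rewrite dbind_massE.
rewrite esum_exchange => [|*]; last by rewrite lee_fin mulr_ge0.
rewrite -[RHS](mass_sum1 p); apply: eq_esum => t _.
under eq_esum do rewrite EFinM.
by rewrite esumZl ?mass_sum1 ?mule1// => u; rewrite lee_fin.
Qed.

Definition dbind T U p k := Dist (@dbind_pmf T U p k).

Lemma dbindE T U (p : dist R T) (k : T -> dist R U) u :
  (dbind p k u)%:E = \esum_(t in [set: T]) (p t * k t u)%:E.
Proof. exact: dbind_massE. Qed.

Lemma dret_pmf T (x : T) : is_pmf (fun t => (t == x)%:R : R).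
Proof.
split => [t|]; first by rewrite ler0n.
rewrite (@esum_supp1 _ _ x) ?eqxx ?lee_fin// => t /negbTE ->//.
Qed.

Definition dret T x := Dist (@dret_pmf T x).

Lemma dbind_ext T U (p : dist R T) (k l : T -> dist R U) :
  (forall t, k t = l t) -> dbind p k = dbind p l.
Proof. by move=> /funext ->. Qed.

Lemma dret_bind T U (x : T) (k : T -> dist R U) : dbind (dret x) k = k x.
Proof.
apply: dist_ext => u; apply: EFin_inj; rewrite dbindE (@esum_supp1 _ _ x) /=.
- by rewrite eqxx mul1r.
- by rewrite lee_fin mulr_ge0.
- by move=> t /negbTE ->; rewrite mul0r.
Qed.

Lemma mul_dbindE T U (c : R) (p : dist R T) (k : T -> dist R U) u : 0 <= c ->
  (c * dbind p k u)%:E = \esum_(t in [set: T]) (c * (p t * k t u))%:E.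
Proof.
move=> c0; rewrite EFinM dbindE -esumZl => // t.
by rewrite lee_fin mulr_ge0.
Qed.

Lemma dbindA T U V (p : dist R T) (k : T -> dist R U) (l : U -> dist R V) :
  dbind (dbind p k) l = dbind p (fun t => dbind (k t) l).
Proof.
apply: dist_ext => v; apply: EFin_inj; rewrite !dbindE.
under eq_esum do rewrite mulrC mul_dbindE//.
rewrite esum_exchange => [|*]; last by rewrite lee_fin !mulr_ge0.
apply: eq_esum => t _; rewrite mul_dbindE//.
by apply: eq_esum => u _; rewrite mulrC mulrA.
Qed.

(** Fubini for two independent draws; this is what allows samples to be reordered in the
    reductions. *)
Lemma dbindC T U V (p : dist R T) (q : dist R U) (k : T -> U -> dist R V) :
  dbind p (fun t => dbind q (k t)) = dbind q (fun u => dbind p (k^~ u)).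
Proof.
apply: dist_ext => v; apply: EFin_inj; rewrite !dbindE.
under eq_esum do rewrite mul_dbindE//.
under [RHS]eq_esum do rewrite mul_dbindE//.
rewrite esum_exchange => [|*]; last by rewrite lee_fin !mulr_ge0.
by apply: eq_esum => u _; apply: eq_esum => t _; rewrite mulrCA.
Qed.

Lemma dbind_ext_supp T U (p : dist R T) (k l : T -> dist R U) :
  (forall t, p t != 0 -> k t = l t) -> dbind p k = dbind p l.
Proof.
move=> kl; apply: dist_ext => u; apply: EFin_inj; rewrite !dbindE.
apply: eq_esum => t _; have [->|/kl ->//] := eqVneq (p t) 0.
by rewrite !mul0r.
Qed.

Definition dmap T U (f : T -> U) (p : dist R T) := dbind p (fun t => dret (f t)).

Lemma dmapE T U (f : T -> U) (p : dist R T) u :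
  (dmap f p u)%:E = \esum_(t in f @^-1` [set u]) (p t)%:E.
Proof.
rewrite dbindE [RHS]esum_mkcond; apply: eq_esum => t _ /=.
case: ifPn => [|/negP]; rewrite inE /= => ftu; first by rewrite ftu eqxx mulr1.
by case: eqP => [/esym//|_]; rewrite mulr0.
Qed.

Lemma dmap_inj T U (f : T -> U) (p : dist R T) t : injective f ->
  dmap f p (f t) = p t.
Proof.
move=> f_inj; apply: EFin_inj; rewrite dmapE [X in esum X](_ : _ = [set t]).
  by rewrite esum_set1// lee_fin mass_ge0.
by apply/seteqP; split => [s /f_inj|s ->].
Qed.

Lemma dmap_eq0 T U (f : T -> U) (p : dist R T) u : (forall t, f t <> u) ->
  dmap f p u = 0.
Proof.
move=> fNu; apply: EFin_inj; rewrite dmapE [X in esum X](_ : _ = set0) ?esum_set0//.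
by apply/seteqP; split => t //= /fNu.
Qed.

Lemma dbind_map T U V (f : T -> U) (p : dist R T) (k : U -> dist R V) :
  dbind (dmap f p) k = dbind p (fun t => k (f t)).
Proof. by rewrite dbindA; apply: dbind_ext => t; rewrite dret_bind. Qed.

(** * Bernoulli and binomial laws *)

Section Mixture.
Variable c : R.
Hypothesis c01 : 0 <= c <= 1.

Lemma bern_pmf : is_pmf (fun b : bool => if b then c else 1 - c).
Proof.
have b0 b : 0 <= (if b then c else 1 - c) by case: b; rewrite ?subr_ge0; case/andP: c01.
by split => //; rewrite esum_bool// -EFinD addrC subrK.
Qed.

Definition bern := Dist bern_pmf.

Lemma bern_bind T (k : bool -> dist R T) t :
  dbind bern k t = c * k true t + (1 - c) * k false t.
Proof.
apply: EFin_inj; rewrite dbindE esum_bool// => b.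
by rewrite lee_fin mulr_ge0 ?mass_ge0// (mass_ge0 bern).
Qed.

(** Counting successes coin by coin matches the recursion of [iid], so that both unfold together in
    an induction. *)
Fixpoint binom m : dist R nat :=
  if m is m'.+1 then dbind bern (fun b => dmap (addn b) (binom m')) else dret 0%N.

Lemma binomS m : binom m.+1 = dbind bern (fun b => dmap (addn b) (binom m)).
Proof. by []. Qed.

Lemma binomE m k : binom m k = binomial_pmf m c k.
Proof.
rewrite /binomial_pmf /unstable.onem.
elim: m k => [|m IHm] [|k]; rewrite ?binomS ?bern_bind.
- by rewrite /= !expr0 mulr1.
- by rewrite /= mulr0n.
- rewrite dmap_eq0 // mulr0 add0r (@dmap_inj _ _ (addn 0%N) _ 0%N)// IHm.
  by rewrite !bin0 !mulr1n !expr0 !mul1r !subn0 exprS.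
rewrite (@dmap_inj _ _ (addn 1%N) _ k)//; last exact: addnI.
rewrite (@dmap_inj _ _ (addn 0%N) _ k.+1)// !IHm binS mulrnDr addrC subSS.
rewrite mulrnAr mulrA -exprS; congr (_ + _).
(* Pascal's rule has split the coefficient. For [m <= k] the failure term has coefficient zero; for
   [k < m] the exponent [m - k] is a true successor and absorbs the factor [1 - c]. *)
have [km|mk] := ltnP k m; last by rewrite bin_small// !mulr0n mulr0.
by rewrite mulrnAr mulrCA -exprS -subSn.
Qed.

Lemma binom_supp m k : binom m k != 0 -> (k <= m)%N.
Proof. by rewrite binomE leqNgt; apply: contraNN => mk; rewrite /binomial_pmf bin_small. Qed.

End Mixture.

(** * Independent samples and the laws of their multisets *)

Fixpoint iid T (p : dist R T) m : dist R (m.-tuple T) :=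
  if m is m'.+1 return dist R (m.-tuple T)
  then dbind p (fun t => dmap (fun s : m'.-tuple T => [tuple of t :: s]) (iid p m'))
  else dret [tuple].

(** Injectivity of [h] in both arguments makes the outcome determine both draws, so a single term of
    the sum survives. *)
Lemma dbind_pair T U V (h : T -> U -> V) (p : dist R T) (q : T -> dist R U) t u :
  (forall a b a' b', h a b = h a' b' -> a = a' /\ b = b') ->
  dbind p (fun t => dmap (h t) (q t)) (h t u) = p t * q t u.
Proof.
move=> h_inj; apply: EFin_inj; rewrite dbindE (@esum_supp1 _ _ t).
- by rewrite dmap_inj// => a b /h_inj [].
- by rewrite lee_fin mulr_ge0// mass_ge0.
- by move=> a /eqP at_; rewrite dmap_eq0 ?mulr0// => b /h_inj [].
Qed.

Lemma iidE T (p : dist R T) m (s : m.-tuple T) :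
  iid p m s = \prod_(i < m) p (tnth s i).
Proof.
elim: m s => [|m IHm] s; first by rewrite tuple0 big_ord0.
case/tupleP: s => t s; rewrite big_ord_recl tnth0.
rewrite [LHS](@dbind_pair _ _ _ (fun t (s : m.-tuple T) => [tuple of t :: s])
  _ (fun=> iid p m)) ?IHm.
  by congr (_ * _); apply: eq_bigr => i _; rewrite tnthS.
by move=> a b a' b' /(congr1 val) [-> /val_inj].
Qed.

Lemma iidS T V (p : dist R T) m (F : m.+1.-tuple T -> dist R V) :
  dbind (iid p m.+1) F
  = dbind p (fun t => dbind (iid p m) (fun s => F [tuple of t :: s])).
Proof. by rewrite dbindA; apply: dbind_ext => t; rewrite dbind_map. Qed.

Lemma iid0 T V (p : dist R T) (F : 0.-tuple T -> dist R V) :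
  dbind (iid p 0) F = F [tuple].
Proof. exact: dret_bind. Qed.

Definition mset_dist T (p q : dist R T) m : dist R {mset T}%mset :=
  dbind p (fun t => dmap (fun s : m.-tuple T => seq_mset (t :: s)) (iid q m)).

(** The monadic law is an iterated sum weighted by the indicator of [h]; it becomes one sum over
    pairs, with the indicator absorbed into the summation set. *)
Lemma multiset_lawE T (p q : dist R T) m h :
  multiset_law p q m h = mset_dist p q m h.
Proof.
rewrite -[RHS]/(fine (mset_dist p q m h)%:E) dbindE; congr fine.
under [RHS]eq_esum do rewrite mul_dbindE ?mass_ge0//.
rewrite esum_esum => [|*]; last by rewrite lee_fin !mulr_ge0 ?mass_ge0.
rewrite [X in _ = esum X _](_ : _ = setT); last by apply/seteqP; split.
rewrite esum_mkcond [RHS](eq_esum (b := fun t : T * m.-tuple T =>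
  if t \in [set t : T * m.-tuple T | seq_mset (t.1 :: t.2) = h]
  then (p t.1 * \prod_(i < m) q (tnth t.2 i))%:E else 0%E))//.
move=> [t s] _ /=; rewrite iidE; case: ifPn => [|/negP]; rewrite inE /=.
  by move=> ->; rewrite eqxx mulr1.
by move=> sNh; case: eqP => [/esym//|_]; rewrite !mulr0.
Qed.

End Dist.

(** * Reductions for an abstract classification [cls] of the outputs *)

Section Reductions.
Context (R : realType) (Y J : choiceType).
Variables (c : R) (c01 : 0 <= c <= 1) (cls : Y -> J).
Implicit Types (p q : dist R Y) (n m k : nat).

(** With [p] the blanket law omega and [c] its weight gamma, this is the law of A_2, [None] being
    \bot. *)
Definition mixture p : dist R (option J) :=
  dbind (bern c01) (fun b => if b then dmap (Some \o cls) p else dret R None).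

Definition pad n (s : seq Y) : seq (option J) :=
  map (Some \o cls) s ++ nseq (n - size s) None.

(** Induction on the coins that decide which samples are [None]. A leading [None] has to move behind
    the other samples, whence the invariance of [F] under permutations. *)
Lemma iid_mixture p m (V : choiceType) (F : seq (option J) -> dist R V) :
  (forall s t, perm_eq s t -> F s = F t) ->
  dbind (iid (mixture p) m) F
  = dbind (binom c01 m) (fun k => dbind (iid p k) (fun s => F (pad m s))).
Proof.
elim: m F => [|m IHm] F Fperm; first by rewrite iid0 dret_bind iid0.
rewrite iidS binomS !dbindA; apply: dbind_ext => b.
have Fcons o : dbind (iid (mixture p) m) (fun s => F [tuple of o :: s]) = _ :=
  IHm (fun s => F (o :: s)) (fun s t st => Fperm _ _ (etrans (perm_cons _ _ _) st)).
rewrite dbind_map; case: b.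
  rewrite dbind_map.
  under dbind_ext => t do rewrite Fcons.
  rewrite dbindC; apply: dbind_ext => k; rewrite iidS.
  by apply: dbind_ext => t; apply: dbind_ext => s; rewrite /pad /= subSS.
(* On a failed coin, [k <= m] holds on the support of the binomial law, so the truncated [m.+1 - k]
   is one more than [m - k] and accounts for the extra [None]. *)
rewrite dret_bind Fcons; apply: dbind_ext_supp => k /binom_supp km.
apply: dbind_ext => s; apply: Fperm.
by rewrite /pad size_tuple subSn// -cat1s perm_catCA.
Qed.

Definition blanket_dist n q p : dist R (nat * {mset Y}%mset)%type :=
  dbind (binom c01 n.-1) (fun k => dmap (fun h => (k, h)) (mset_dist q p k)).

Definition clone_dist n q p : dist R {mset (option J)}%mset :=
  mset_dist (dmap (Some \o cls) q) (mixture p) n.-1.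

(** The first user's sample is never \bot and always present, so the histogram has [n.-1.+1]
    entries, which is [n] for positive [n]. *)
Lemma clone_distE n q p : clone_dist n q p
  = dbind (binom c01 n.-1) (fun k => dbind q (fun y => dbind (iid p k)
      (fun s => dret R (seq_mset (pad n.-1.+1 (y :: s)))))).
Proof.
rewrite /clone_dist /mset_dist dbind_map [RHS]dbindC; apply: dbind_ext => y.
rewrite /dmap (@iid_mixture _ _ _ (fun s => dret R (seq_mset (Some (cls y) :: s)))).
  by apply: dbind_ext => k; apply: dbind_ext => s; rewrite /pad /= subSS.
by move=> s t st; congr dret; apply/eq_seq_msetP; rewrite perm_cons.
Qed.

Definition to_clone n (z : (nat * {mset Y}%mset)%type) : dist R {mset (option J)}%mset :=
  dret R (seq_mset (pad n.-1.+1 z.2)).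

Lemma to_cloneE n q p : dbind (blanket_dist n q p) (to_clone n) = clone_dist n q p.
Proof.
rewrite clone_distE dbindA; apply: dbind_ext => k.
rewrite dbind_map dbindA; apply: dbind_ext => y.
rewrite dbind_map; apply: dbind_ext => s; congr dret; apply/eq_seq_msetP.
(* The multiset is enumerated in some other order; padding depends on the order only up to a
   permutation, which [seq_mset] forgets. *)
have ys := perm_eq_seq_mset (y :: s).
by rewrite /pad (perm_size ys) perm_cat2r perm_map.
Qed.

(** * Resampling outputs from their classes *)

Variable Q : J -> dist R Y.

(** The recursion needs an ordered list; [resample_perm] makes the order immaterial, so that it can
    act on histograms. *)
Fixpoint resample (s : seq J) : dist R {mset Y}%mset :=
  if s is j :: s' then
    dbind (Q j) (fun y => dmap (fun h => y +` h)%mset (resample s'))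
  else dret R mset0%mset.

Lemma resample_swap i j s : resample [:: i, j & s] = resample [:: j, i & s].
Proof.
rewrite /= /dmap; under dbind_ext => y do rewrite dbindA.
under [RHS]dbind_ext => y do rewrite dbindA.
rewrite dbindC; apply: dbind_ext => y; apply: dbind_ext => z.
by rewrite !dbind_map; apply: dbind_ext => h; rewrite msetDCA.
Qed.

Lemma resample_perm s t : perm_eq s t -> resample s = resample t.
Proof.
elim: s t => [|j s IHs] t; first by rewrite perm_sym => /perm_nilP ->.
(* The occurrence of [j] in [t] is split off, then exchanged past [t1] by repeated use of
   [resample_swap]. *)
move=> st; have /path.splitPr jt : j \in t by rewrite -(perm_mem st) mem_head.
case: jt st => t1 t2; rewrite perm_sym -cat1s perm_catCA perm_cons perm_sym.
move=> /IHs st; transitivity (resample (j :: t1 ++ t2)); first by rewrite /= st.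
elim: t1 {st} => // i t1 IHt.
by rewrite resample_swap /= -/(resample (j :: t1 ++ t2)) IHt.
Qed.

(** One step for two uses: with [q = p] it is the induction over the common samples, with [q] the
    law of the first user it rebuilds the blanket output. *)
Lemma resample_step q p m : dbind q (Q \o cls) = q ->
  dbind (iid p m) (fun s => resample (map cls s))
    = dmap (fun s : m.-tuple Y => seq_mset s) (iid p m) ->
  dbind q (fun y => dbind (iid p m) (fun s => resample (map cls (y :: s))))
    = mset_dist q p m.
Proof.
(* The redraw for [y] is brought forward, before the other samples, so that drawing [y] and
   redrawing from its class collapses to [q]. *)
move=> qQ pQ; transitivity (dbind q (fun y => dbind (Q (cls y)) (fun z =>
    dbind (iid p m) (fun s => dmap (fun h => z +` h)%mset (resample (map cls s)))))).
  by apply: dbind_ext => y; rewrite dbindC.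
rewrite -(dbindA q (Q \o cls)) qQ; apply: dbind_ext => y.
rewrite -dbindA pQ dbind_map; apply: dbind_ext => s.
by rewrite -mset_cons.
Qed.

Lemma resample_iid p m : dbind p (Q \o cls) = p ->
  dbind (iid p m) (fun s => resample (map cls s))
  = dmap (fun s : m.-tuple Y => seq_mset s) (iid p m).
Proof.
move=> pQ; elim: m => [|m IHm]; first by rewrite /dmap !iid0 /= -(seq_mset_id mset0) enum_mset0.
rewrite iidS (resample_step pQ IHm) /dmap iidS.
by apply: dbind_ext => y; rewrite /dmap.
Qed.

(** [pmap id] discards \bot; the predecessor discounts the first user's sample, since the blanket
    output records only the number of omega samples. *)
Definition to_blanket (u : {mset (option J)}%mset) : dist R (nat * {mset Y}%mset)%type :=
  let s := pmap id u in dmap (fun h => ((size s).-1, h)) (resample s).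

Lemma to_blanketE n q p : dbind q (Q \o cls) = q -> dbind p (Q \o cls) = p ->
  dbind (clone_dist n q p) to_blanket = blanket_dist n q p.
Proof.
move=> qQ pQ; rewrite clone_distE dbindA; apply: dbind_ext => k.
rewrite -(resample_step qQ (resample_iid k pQ)) /dmap !dbindA.
apply: dbind_ext => y; rewrite !dbindA; apply: dbind_ext => s.
rewrite dret_bind /to_blanket.
(* Discarding [None] undoes the padding, up to the order of enumeration. *)
have ys : perm_eq (pmap id (seq_mset (pad n.-1.+1 (y :: s)))) (map cls (y :: s)).
  rewrite (perm_trans (perm_pmap _ (perm_eq_seq_mset _)))// /pad pmap_cat.
  rewrite [pmap _ (nseq _ _)](_ : _ = [::]); last by elim: (n.-1.+1 - _)%N.
  by rewrite cats0; elim: (y :: tval s) => //= z t IHt; rewrite perm_cons.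
by rewrite (resample_perm ys) (perm_size ys) size_map /= size_tuple.
Qed.

End Reductions.

(** * Real-valued sums of finite total *)

Section Rsum.
Context (R : realType) (T : choiceType).
Implicit Types (A : set T) (f : T -> R).

Lemma rsumE A f : (forall t, 0 <= f t) ->
  (\esum_(t in [set: T]) (f t)%:E < +oo)%E ->
  (rsum A f)%:E = \esum_(t in A) (f t)%:E.
Proof.
move=> f0 foo; rewrite /rsum fineK// ge0_fin_numE; last by apply: esum_ge0 => *; rewrite lee_fin.
apply: le_lt_trans foo; rewrite esum_mkcond; apply: le_esum => t _.
by case: ifP; rewrite lee_fin.
Qed.

End Rsum.

(** * The infimum, the blanket law and the ratio classes *)

Section Ratio.
Context (R : realType) (X : Type) (Y : choiceType) (Rnd : X -> Y -> R).
Context (x10 x11 : X).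
Hypothesis Rnd_pmf : is_markov Rnd.
Hypothesis ratios_defined :
  forall y : Y, 0 < Rnd x10 y \/ 0 < Rnd x11 y -> 0 < inf_mass Rnd y.

Local Notation infR := (inf_mass Rnd).
Local Notation gam := (blanket_gamma Rnd).
Local Notation omg := (blanket_omega Rnd).
Local Notation class := (ratio_class Rnd x10 x11).
Local Notation J := (set_type (ratio_values Rnd x10 x11)).

Definition Rnd_dist x := Dist (Rnd_pmf x).

Lemma inf_mass_ge0 y : 0 <= infR y.
Proof.
apply: lb_le_inf; first by exists (Rnd x10 y), x10.
by move=> _ [x _ <-]; exact: (mass_ge0 (Rnd_dist x)).
Qed.
Hint Resolve inf_mass_ge0 : core.

Lemma inf_mass_le x y : infR y <= Rnd x y.
Proof.
apply: ge_inf; last by exists x.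
by exists 0 => _ [z _ <-]; exact: (mass_ge0 (Rnd_dist z)).
Qed.

Lemma esum_inf_le1 : (\esum_(y in [set: Y]) (infR y)%:E <= 1)%E.
Proof.
rewrite -(mass_sum1 (Rnd_dist x10)); apply: le_esum => y _.
by rewrite lee_fin inf_mass_le.
Qed.

Lemma rsum_infE (A : set Y) : (rsum A infR)%:E = \esum_(y in A) (infR y)%:E.
Proof. by rewrite rsumE// (le_lt_trans esum_inf_le1) ?ltry. Qed.

Lemma le_rsum_inf (A : set Y) y : A y -> infR y <= rsum A infR.
Proof.
move=> Ay; rewrite -lee_fin rsum_infE.
by apply: (@le_esum1 _ _ _ (fun y => (infR y)%:E)) => // t; rewrite lee_fin.
Qed.

Lemma gamma01 : 0 <= gam <= 1.
Proof.
apply/andP; split; first by apply/fine_ge0/esum_ge0 => y _; rewrite lee_fin.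
by rewrite -lee_fin rsum_infE esum_inf_le1.
Qed.

(** Were the infimum zero everywhere, [ratios_defined] would leave [Rnd x10] without mass. This
    gives gamma > 0 and a default index for [ratio_index]. *)
Lemma inf_mass_gt0_ex : exists y, 0 < infR y.
Proof.
apply/not_existsP => infN.
suff : (\esum_(y in [set: Y]) (Rnd x10 y)%:E = 0)%E.
  by rewrite (mass_sum1 (Rnd_dist x10)) => /eqP; rewrite eqe oner_eq0.
rewrite esum1// => y _; apply/congr1/eqP; apply: contrapT => RyN0; apply: (infN y).
apply: ratios_defined; left; rewrite lt_def (mass_ge0 (Rnd_dist x10)) andbT.
exact/negP.
Qed.

Lemma gamma_gt0 : 0 < gam.
Proof. by have [y /lt_le_trans] := inf_mass_gt0_ex; apply; exact: le_rsum_inf. Qed.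

Lemma gamma_omega y : gam * omg y = infR y.
Proof. by rewrite /blanket_omega mulrC divfK// gt_eqF// gamma_gt0. Qed.

Lemma omega_pmf : is_pmf omg.
Proof.
have g0 := gamma_gt0; split=> [y|]; first by rewrite divr_ge0// ltW.
have gi : 0 <= gam^-1 by rewrite invr_ge0 ltW.
under eq_esum do rewrite /blanket_omega mulrC EFinM.
rewrite esumZl// => [|y]; last by rewrite lee_fin.
by rewrite -rsum_infE -EFinM mulVf ?gt_eqF.
Qed.

Definition omega_dist := Dist omega_pmf.

Lemma ratio_values_ratio y : 0 < infR y ->
  ratio_values Rnd x10 x11 (Rnd x10 y / infR y, Rnd x11 y / infR y).
Proof. by move=> y0; exists y. Qed.

Lemma ratio_values_neq0 : exists r, ratio_values Rnd x10 x11 r.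
Proof. by have [y /ratio_values_ratio ?] := inf_mass_gt0_ex; eexists; eassumption. Qed.

(* Points with zero infimum belong to no class; they carry no mass, so they are
   sent to an arbitrary index. *)
Definition ratio_index (y : Y) : J :=
  insubd (SigSub (mem_set (projT2 (cid ratio_values_neq0))))
    (Rnd x10 y / infR y, Rnd x11 y / infR y).

Lemma ratio_indexP y (j : J) : 0 < infR y ->
  class (val j) y <-> ratio_index y = j.
Proof.
move=> y0; have vy : val (ratio_index y) = (Rnd x10 y / infR y, Rnd x11 y / infR y).
  by rewrite /ratio_index val_insubd mem_set//; exact: ratio_values_ratio.
split => [[_ e1 e2]|<-]; last by split; rewrite ?vy.
by apply: val_inj; rewrite vy e1 e2; case: (val j).
Qed.

(** The two sets can differ only at points of zero infimum, where [q] vanishes. *)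
Lemma esum_class (q : Y -> R) (j : J) : (forall y, q y != 0 -> 0 < infR y) ->
  \esum_(y in class (val j)) (q y)%:E
  = \esum_(y in ratio_index @^-1` [set j]) (q y)%:E.
Proof.
move=> q_supp; rewrite esum_mkcond [RHS]esum_mkcond; apply: eq_esum => y _.
have [->|/q_supp y0] := eqVneq (q y) 0; first by rewrite !if_same.
by congr (if _ then _ else _); apply/idP/idP; rewrite !inE => /(ratio_indexP j y0).
Qed.

Lemma dmap_classE (q : dist R Y) (j : J) : (forall y, q y != 0 -> 0 < infR y) ->
  dmap ratio_index q j = rsum (class (val j)) q.
Proof. by move=> q_supp; apply: EFin_inj; rewrite dmapE /rsum esum_class// -dmapE. Qed.

(** With [s = r.1] it gives [ratio_a] as [r.1] times [ratio_c]; with [s = gam^-1], the mass of the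
    class under omega. *)
Lemma rsum_classZ (q : Y -> R) (s : R) (r : R * R) : 0 <= s ->
  (forall y, class r y -> q y = s * infR y) ->
  rsum (class r) q = s * ratio_c Rnd x10 x11 r.
Proof.
move=> s0 qE; apply: EFin_inj; rewrite EFinM rsum_infE -esumZl//.
  rewrite /rsum; under eq_esum => y ry do rewrite qE// EFinM.
  rewrite esumZl// -?rsum_infE//.
  by move=> y; rewrite lee_fin.
by move=> y; rewrite lee_fin.
Qed.

Lemma ratio_c_gt0 (j : J) : 0 < ratio_c Rnd x10 x11 (val j).
Proof.
have [y jy] := set_mem (valP j); case: (jy) => y0 _ _.
exact: lt_le_trans y0 (le_rsum_inf jy).
Qed.

Lemma ratio_fst (r : R * R) y : class r y -> Rnd x10 y = r.1 * infR y.
Proof. by case=> y0 <- _; rewrite divfK// gt_eqF. Qed.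

Lemma ratio_snd (r : R * R) y : class r y -> Rnd x11 y = r.2 * infR y.
Proof. by case=> y0 _ <-; rewrite divfK// gt_eqF. Qed.

Lemma ratio_val_gt0 (j : J) : 0 < (val j).1 /\ 0 < (val j).2.
Proof.
have [y [y0 <- <-]] := set_mem (valP j).
by split; rewrite divr_gt0// (lt_le_trans y0)// inf_mass_le.
Qed.

(** In the quotient by [ratio_a] the ratio [r.1] cancels: [ratio_Q] is the infimum normalised on its
    class, so it does not favour [x10] over [x11]. *)
Lemma ratio_QE (j : J) y :
  ratio_Q Rnd x10 x11 (val j) y =
  if `[< class (val j) y >] then infR y / ratio_c Rnd x10 x11 (val j) else 0.
Proof.
rewrite /ratio_Q; case: asboolP => // jy; have [r0 _] := ratio_val_gt0 j.
rewrite /ratio_a (rsum_classZ (ltW r0) (ratio_fst (r := val j))) (ratio_fst jy).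
by rewrite invfM mulrACA divff ?mul1r// gt_eqF.
Qed.

Lemma ratio_Q_pmf (j : J) : is_pmf (ratio_Q Rnd x10 x11 (val j)).
Proof.
have c0 := ratio_c_gt0 j; split=> [y|].
  by rewrite ratio_QE; case: ifP => // _; rewrite divr_ge0// ltW.
transitivity (\esum_(y in class (val j)) ((ratio_c Rnd x10 x11 (val j))^-1%:E * (infR y)%:E))%E.
  rewrite [RHS]esum_mkcond; apply: eq_esum => y _; rewrite ratio_QE.
  by case: asboolP => jy; [rewrite mem_set// mulrC|rewrite memNset].
rewrite esumZl ?invr_ge0 ?ltW// => [|y]; last by rewrite lee_fin.
by rewrite -rsum_infE -EFinM mulVf// gt_eqF.
Qed.

Definition ratio_Q_dist (j : J) := Dist (ratio_Q_pmf j).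

(** Sufficient for [ratio_Q] to be the conditional law of [q] on each class that [q] charges: no
    mass outside the classes, and constant density relative to the infimum within each. *)
Definition class_proportional (q : Y -> R) : Prop :=
  (forall y, q y != 0 -> 0 < infR y) /\
  (forall j : J, exists2 s, 0 <= s & forall y, class (val j) y -> q y = s * infR y).

(** Only the class of [y] contributes: its mass is [s] times [ratio_c], and [ratio_Q] at [y] is
    [infR y] over [ratio_c], so the product is [s * infR y], which is [q y]. *)
Lemma dbind_ratio_Q (q : dist R Y) : class_proportional q ->
  dbind q (ratio_Q_dist \o ratio_index) = q.
Proof.
move=> [q_supp qE]; rewrite -(dbind_map ratio_index q ratio_Q_dist).
apply: dist_ext => y; apply: EFin_inj; rewrite dbindE.
(* At zero infimum both sides vanish: [q] by its support condition, [ratio_Q] because no class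
   contains [y]. *)
have [y0|yN0] := boolP (0 < infR y); last first.
  rewrite esum1; last first => [j _|].
    rewrite /= ratio_QE; case: asboolP => [[y0]|_]; last by rewrite mulr0.
    by rewrite y0 in yN0.
  by have [->//|/q_supp y0] := eqVneq (q y) 0; rewrite y0 in yN0.
rewrite (@esum_supp1 _ _ (ratio_index y)); last 2 first.
- by rewrite lee_fin mulr_ge0 ?mass_ge0.
- move=> j jN; rewrite /= ratio_QE; case: asboolP; last by rewrite mulr0.
  by move=> /ratio_indexP -/(_ y0) /esym/eqP; rewrite (negbTE jN).
have jy : class (val (ratio_index y)) y by apply/ratio_indexP.
have [s s0 qs] := qE (ratio_index y).
rewrite dmap_classE// (rsum_classZ s0 qs) /= ratio_QE asboolT// qs//.
rewrite -mulrA (mulrC (ratio_c _ _ _ _)) divfK//.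
by rewrite gt_eqF// ratio_c_gt0.
Qed.

End Ratio.

(** * Decomposition and equivalence for the ratio classes *)

Section RatioClone.
Context (R : realType) (X : Type) (Y : choiceType) (Rnd : X -> Y -> R).
Context (x10 x11 : X).
Hypothesis Rnd_pmf : is_markov Rnd.
Hypothesis ratios_defined :
  forall y : Y, 0 < Rnd x10 y \/ 0 < Rnd x11 y -> 0 < inf_mass Rnd y.

Local Notation infR := (inf_mass Rnd).
Local Notation gam := (blanket_gamma Rnd).
Local Notation class := (ratio_class Rnd x10 x11).
Local Notation J := (set_type (ratio_values Rnd x10 x11)).
Local Notation clone := (ratio_clone Rnd x10 x11).
Local Notation P x := (Rnd_dist Rnd_pmf x).
Local Notation omd := (omega_dist Rnd_pmf ratios_defined).
Local Notation idx := (ratio_index Rnd_pmf ratios_defined).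
Local Notation Qd := (ratio_Q_dist Rnd_pmf (x10 := x10) (x11 := x11)).

Lemma class_proportional_fst : class_proportional Rnd x10 x11 (P x10).
Proof.
split=> [y y0|j].
  by apply: ratios_defined; left; rewrite lt_def y0 (mass_ge0 (P x10)).
by exists (val j).1; [apply/ltW; case: (ratio_val_gt0 Rnd_pmf j)|exact: ratio_fst].
Qed.

Lemma class_proportional_snd : class_proportional Rnd x10 x11 (P x11).
Proof.
split=> [y y0|j].
  by apply: ratios_defined; right; rewrite lt_def y0 (mass_ge0 (P x11)).
by exists (val j).2; [apply/ltW; case: (ratio_val_gt0 Rnd_pmf j)|exact: ratio_snd].
Qed.

Lemma class_proportional_omega : class_proportional Rnd x10 x11 omd.
Proof.
split=> [y|j]; last first.
  exists gam^-1; last by move=> y _; rewrite mulrC.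
  by rewrite invr_ge0 ltW// (gamma_gt0 Rnd_pmf ratios_defined).
rewrite mulf_eq0 => /norP[y0 _].
by rewrite lt_def y0 (inf_mass_ge0 x10 Rnd_pmf).
Qed.

Lemma dmap_fst j : dmap idx (P x10) j = ratio_a Rnd x10 x11 (val j).
Proof. by rewrite dmap_classE; case: class_proportional_fst. Qed.

Lemma dmap_snd j : dmap idx (P x11) j = ratio_b Rnd x10 x11 (val j).
Proof. by rewrite dmap_classE; case: class_proportional_snd. Qed.

Lemma dmap_omega j : gam * dmap idx omd j = ratio_c Rnd x10 x11 (val j).
Proof.
have g0 := gamma_gt0 Rnd_pmf ratios_defined.
rewrite dmap_classE; last by case: class_proportional_omega.
rewrite (rsum_classZ (s := gam^-1) (x10 := x10) Rnd_pmf) ?invr_ge0 ?(ltW g0)//.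
  by rewrite mulVKf// gt_eqF.
by move=> y _; rewrite mulrC.
Qed.

(** Invariance under redrawing, read pointwise, is the clone decomposition of [q], with the class
    masses as coefficients. *)
Lemma ratio_mixture (q : dist R Y) y : class_proportional Rnd x10 x11 q ->
  (q y)%:E = \esum_(j in [set: J]) (dmap idx q j * ratio_Q Rnd x10 x11 (val j) y)%:E.
Proof.
by move=> /(dbind_ratio_Q Rnd_pmf ratios_defined) {1}<-; rewrite -dbind_map dbindE.
Qed.

Lemma ratio_mixture_inf y :
  \esum_(j in [set: J]) (ratio_c Rnd x10 x11 (val j) * ratio_Q Rnd x10 x11 (val j) y)%:E
  = (infR y)%:E.
Proof.
have /andP[g0 _] := gamma01 x10 Rnd_pmf.
rewrite -(gamma_omega Rnd_pmf ratios_defined) EFinM.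
rewrite (ratio_mixture y class_proportional_omega) -esumZl// => [|j].
  by apply: eq_esum => j _; rewrite -EFinM mulrA dmap_omega.
by rewrite lee_fin mulr_ge0// ?mass_ge0// (mass_ge0 (Qd j)).
Qed.

Lemma esum_ratio_c : \esum_(j in [set: J]) (ratio_c Rnd x10 x11 (val j))%:E = gam%:E.
Proof.
have /andP[g0 _] := gamma01 x10 Rnd_pmf.
under eq_esum do rewrite -dmap_omega EFinM.
by rewrite esumZl ?mass_sum1 ?mule1// => j; rewrite lee_fin mass_ge0.
Qed.

Lemma ratio_betaE : clone_beta clone = 1 - gam.
Proof. by rewrite /= /rsum esum_ratio_c. Qed.

Lemma esum_leftover x : \esum_(y in [set: Y]) (Rnd x y - infR y)%:E = (1 - gam)%:E.
Proof.
have i0 := inf_mass_ge0 x10 Rnd_pmf.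
have d0 y : 0 <= Rnd x y - infR y by rewrite subr_ge0 (inf_mass_le Rnd_pmf).
have : (\esum_(y in [set: Y]) (Rnd x y - infR y)%:E + gam%:E = 1)%E.
  rewrite (rsum_infE x10 Rnd_pmf) -esumD => [|y _|y _]; rewrite ?lee_fin//.
  rewrite -[RHS](mass_sum1 (P x)); apply: eq_esum => y _.
  by rewrite -EFinD subrK.
by move=> sum1; rewrite EFinB -sum1 addeK.
Qed.

Lemma leftoverP x (L : Y -> R) : is_leftover Rnd clone x L ->
  is_pmf L /\ forall y, Rnd x y = infR y + clone_beta clone * L y.
Proof.
have d0 y : 0 <= Rnd x y - infR y by rewrite subr_ge0 (inf_mass_le Rnd_pmf).
have /andP[_ g1] := gamma01 x10 Rnd_pmf.
rewrite /is_leftover ratio_betaE => -[LN0 L0].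
(* If gamma is 1, the gaps [Rnd x y - infR y] are nonnegative with sum zero, hence all zero, and any
   distribution [L] fits. *)
have [g_eq1|gN1] := eqVneq (1 - gam) 0.
  split=> [|y]; first exact: L0.
  rewrite g_eq1 mul0r addr0; apply/eqP; rewrite -subr_eq0 eq_le d0 andbT.
  rewrite -lee_fin -g_eq1 -(esum_leftover x).
  by apply: (@le_esum1 _ _ _ (fun y => (Rnd x y - infR y)%:E)) => // t; rewrite lee_fin.
have LE y : L y = (1 - gam)^-1 * (Rnd x y - infR y).
  by rewrite LN0//= /rsum ratio_mixture_inf.
have gi : 0 <= (1 - gam)^-1 by rewrite invr_ge0 subr_ge0.
split; last by move=> y; rewrite LE mulVKf// addrC subrK.
split=> [y|]; first by rewrite LE mulr_ge0.
under eq_esum do rewrite LE EFinM.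
rewrite esumZl//.
by rewrite esum_leftover -EFinM mulVf.
Qed.

Lemma ratio_clone_decomposition n (xs : 'I_n.-1 -> X) (L : X -> Y -> R) :
  (forall i, is_leftover Rnd clone (xs i) (L (xs i))) ->
  is_clone_decomposition Rnd x10 x11 clone xs L.
Proof.
move=> leftL; have /andP[g0 g1] := gamma01 x10 Rnd_pmf.
have c0 (j : J) : 0 <= ratio_c Rnd x10 x11 (val j) by exact: ltW (ratio_c_gt0 _ j).
split; first by move=> j; exact: (mass_pmf (Qd j)).
split; first by rewrite -[@clone_a _ _ _](funext dmap_fst); exact: mass_pmf.
split; first by rewrite -[@clone_b _ _ _](funext dmap_snd); exact: mass_pmf.
split; first exact: c0.
split; first by rewrite ratio_betaE subr_ge0.
split; first by rewrite ratio_betaE esum_ratio_c -EFinD subrK.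
split; first by move=> i; case: (leftoverP (leftL i)).
split.
  move=> y; rewrite (ratio_mixture y class_proportional_fst).
  by apply: eq_esum => j _; rewrite dmap_fst.
split.
  move=> y; rewrite (ratio_mixture y class_proportional_snd).
  by apply: eq_esum => j _; rewrite dmap_snd.
move=> i y; have [_ ->] := leftoverP (leftL i).
by rewrite EFinD ratio_mixture_inf.
Qed.

Lemma with_bot_dmap (q : dist R Y) (w : J -> R) :
  (forall j, dmap idx q j = w j) ->
  with_bot (D := clone) w 0 = dmap (Some \o idx) q.
Proof.
move=> qw; apply/funext => -[j|]; last by rewrite dmap_eq0.
rewrite /with_bot -qw -(@dmap_inj _ _ _ Some (dmap idx q) j); last by move=> ? ? [].
by congr (mass _ _); exact: (dbind_map idx q).
Qed.

(** Success of the coin gives class [j] with gamma times its omega mass, that is [ratio_c]; failure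
    gives \bot with the remaining [1 - gam], that is beta. *)
Lemma with_bot_mixture :
  with_bot (@clone_c _ _ clone) (clone_beta clone)
  = mixture (gamma01 x10 Rnd_pmf) idx omd.
Proof.
apply/funext => o; rewrite /mixture bern_bind.
case: o => [j|]; rewrite /with_bot.
  rewrite -(@with_bot_dmap omd _ (fun=> erefl)) /= dmap_omega.
  by rewrite mulr0 addr0.
by rewrite dmap_eq0// mulr0 add0r ratio_betaE /= mulr1.
Qed.

Lemma clone_lawE n (q : dist R Y) (w : J -> R) :
  (forall j, dmap idx q j = w j) ->
  clone_law (D := clone) n w = clone_dist (gamma01 x10 Rnd_pmf) idx n q omd.
Proof.
move=> qw; apply/funext => h.
by rewrite /clone_law (with_bot_dmap qw) with_bot_mixture multiset_lawE.
Qed.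

Lemma blanket_lawE n x :
  blanket_law Rnd n x = blanket_dist (gamma01 x10 Rnd_pmf) n (P x) omd.
Proof.
apply/funext => -[k h]; rewrite /blanket_law /blanket_dist.
rewrite (dbind_pair (h := pair)); last by move=> ? ? ? ? [].
by rewrite binomE -multiset_lawE.
Qed.

Lemma postprocesses_dbind (T U : choiceType) (p : dist R T) (f : T -> dist R U) q :
  dbind p f = q -> postprocesses (fun t => f t : U -> R) p q.
Proof. by move=> <- u; rewrite dbindE. Qed.

(** [to_clone] depends only on the classes and [to_blanket] only on the laws [Qd], so the same pair
    of maps serves both inputs of the first user. *)
Lemma ratio_clone_equivalent : equivalent_to_blanket Rnd x10 x11 clone.
Proof.
move=> n _; split.
  exists (fun z => to_clone R idx n z); split; first by move=> z; exact: mass_pmf.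
  rewrite (clone_lawE _ dmap_fst) (clone_lawE _ dmap_snd) !blanket_lawE.
  by split; apply: postprocesses_dbind; exact: to_cloneE.
exists (fun u => to_blanket Qd u); split; first by move=> u; exact: mass_pmf.
rewrite (clone_lawE _ dmap_fst) (clone_lawE _ dmap_snd) !blanket_lawE.
split; apply: postprocesses_dbind; apply: to_blanketE; apply: dbind_ratio_Q.
- exact: class_proportional_fst.
- exact: class_proportional_omega.
- exact: class_proportional_snd.
- exact: class_proportional_omega.
Qed.

End RatioClone.

Theorem theorem7 (R : realType) (X : Type) (Y : choiceType)
    (Rnd : X -> Y -> R) (x10 x11 : X)
    (Rnd_randomizer : is_markov Rnd)
    (ratios_defined : forall y : Y, 0 < Rnd x10 y \/ 0 < Rnd x11 y ->
       0 < inf_mass Rnd y) :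
  (forall (n : nat) (xs : 'I_n.-1 -> X) (L : X -> Y -> R), (0 < n)%N ->
     (forall i, is_leftover Rnd (ratio_clone Rnd x10 x11) (xs i) (L (xs i))) ->
     is_clone_decomposition Rnd x10 x11 (ratio_clone Rnd x10 x11) xs L)
  /\ (forall r : set_type (ratio_values Rnd x10 x11),
        ratio_c Rnd x10 x11 (val r)
        = rsum (ratio_class Rnd x10 x11 (val r))
               (fun y => blanket_gamma Rnd * blanket_omega Rnd y))
  /\ equivalent_to_blanket Rnd x10 x11 (ratio_clone Rnd x10 x11).
Proof.
split=> [n xs L _|]; first exact: ratio_clone_decomposition.
split=> [r|]; last exact: ratio_clone_equivalent.
by congr rsum; apply/funext => y; rewrite (gamma_omega Rnd_randomizer ratios_defined).
Qed.
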